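(* Let $L$ be the list monad on $\mathbf{Set}$. There is no distributive law $LL \Rightarrow LL$ of the list monad over itself.
   Context: The list monad $(L,\eta^L,\mu^L)$ on $\mathbf{Set}$: $L X$ is the set of all finite lists (including the empty list) with elements in $X$; $\eta^L_X(x) = [x]$; $\mu^L_X$ concatenates a list of lists into a single list. For monads $(S,\eta^S,\mu^S)$, $(T,\eta^T,\mu^T)$, a distributive law $\lambda: ST \Rightarrow TS$ is a natural transformation with $\lambda\cdot\eta^S T = T\eta^S$, $\lambda\cdot S\eta^T=\eta^T S$, $\lambda\cdot\mu^S T = T\mu^S\cdot\lambda S\cdot S\lambda$ and $\lambda\cdot S\mu^T=\mu^T S\cdot T\lambda\cdot\lambda T$. Here $S=T=L$. *)

(* Defs.v *)
From mathcomp Require Import all_boot.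

Set Implicit Arguments.
Unset Strict Implicit.
Unset Printing Implicit Defensive.

(* The category Set is rendered as types and functions. Equations between     *)
(* maps are stated pointwise, which is equality of maps under functional      *)
(* extensionality; this lets the list monad be built without axioms.          *)

Record monad := Monad {
  mobj :> Type -> Type;
  fmap : forall X Y : Type, (X -> Y) -> mobj X -> mobj Y;
  eta : forall X : Type, X -> mobj X;
  mu : forall X : Type, mobj (mobj X) -> mobj X;
  fmap_id : forall X : Type, @fmap X X id =1 id;
  fmap_comp : forall (X Y Z : Type) (g : Y -> Z) (f : X -> Y),
    fmap (g \o f) =1 fmap g \o fmap f;
  eta_natural : forall (X Y : Type) (f : X -> Y),
    fmap f \o @eta X =1 @eta Y \o f;
  mu_natural : forall (X Y : Type) (f : X -> Y),
    fmap f \o @mu X =1 @mu Y \o fmap (fmap f);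
  mu_eta : forall X : Type, @mu X \o @eta (mobj X) =1 id;
  mu_fmap_eta : forall X : Type, @mu X \o fmap (@eta X) =1 id;
  mu_assoc : forall X : Type, @mu X \o @mu (mobj X) =1 @mu X \o fmap (@mu X)
}.

Arguments fmap m [X Y] f _.
Arguments eta m X _ : clear implicits.
Arguments mu m X _ : clear implicits.

Record is_distributive_law (S T : monad)
    (lambda : forall X : Type, S (T X) -> T (S X)) : Prop := {
  law_natural : forall (X Y : Type) (f : X -> Y),
    lambda Y \o fmap S (fmap T f) =1 fmap T (fmap S f) \o lambda X;
  law_etaS : forall X : Type, lambda X \o eta S (T X) =1 fmap T (eta S X);
  law_etaT : forall X : Type, lambda X \o fmap S (eta T X) =1 eta T (S X);
  law_muS : forall X : Type,
    lambda X \o mu S (T X)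
      =1 fmap T (mu S X) \o lambda (S X) \o fmap S (lambda X);
  law_muT : forall X : Type,
    lambda X \o fmap S (mu T X)
      =1 mu T (S X) \o fmap T (lambda X) \o lambda (T X)
}.

Lemma list_eta_natural (X Y : Type) (f : X -> Y) :
  map f \o (fun x => [:: x]) =1 (fun y => [:: y]) \o f.
Proof. by []. Qed.

Lemma list_mu_natural (X Y : Type) (f : X -> Y) :
  map f \o flatten =1 flatten \o map (map f).
Proof. by move=> s; rewrite /= map_flatten. Qed.

Lemma list_mu_eta (X : Type) : flatten \o (fun s : seq X => [:: s]) =1 id.
Proof. by move=> s; rewrite /= cats0. Qed.

Lemma list_mu_fmap_eta (X : Type) :
  flatten \o map (fun x : X => [:: x]) =1 id.
Proof. by move=> s; rewrite /= flatten_seq1. Qed.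

Lemma list_mu_assoc (X : Type) :
  flatten \o flatten =1 flatten \o map (@flatten X).
Proof. by elim=> //= s ss IH; rewrite flatten_cat IH. Qed.

Definition list_monad : monad := {|
  mobj := seq;
  fmap := @map;
  eta := fun X x => [:: x];
  mu := @flatten;
  fmap_id := @map_id;
  fmap_comp := fun X Y Z g f => map_comp g f;
  eta_natural := list_eta_natural;
  mu_natural := list_mu_natural;
  mu_eta := list_mu_eta;
  mu_fmap_eta := list_mu_fmap_eta;
  mu_assoc := list_mu_assoc
|}.

(* Main.v *)
Require Import Defs.
From mathcomp Require Import all_boot.

(** Read [lambda] as rewriting a product of sums into a sum of products.
Substituting the empty product for [a] in the expansion of [a * (c + d)] shows
that the expansion has two products, each with a single letter other than [a];
substituting the empty sum for [d], and then for [c], identifies them as [a c]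
and [a d]. The same holds on the other side, so both distributivity laws are
forced. Expanding [(a + b) * (c + d)] with either of them first then gives two
sums of four products in different orders. *)

Set Implicit Arguments.
Unset Strict Implicit.
Unset Printing Implicit Defensive.

(* At the inner monad this substitutes the empty sum for the letter [k], and at
   the outer monad the empty product. *)
Definition erase (k x : nat) : seq nat := if x == k then [::] else [:: x].

Lemma flatten_map_erase (k : nat) (s : seq nat) :
  flatten (map (erase k) s) = filter (predC1 k) s.
Proof. by elim: s => //= x s ->; rewrite /erase; case: eqP. Qed.

Lemma map_erase_id (k : nat) (s : seq nat) :
  k \notin s -> map (erase k) s = map (fun x => [:: x]) s.
Proof.
move=> ks; apply/eq_in_map => y ys; rewrite /erase.
by case: eqP => // yk; rewrite -yk ys in ks.
Qed.

Section ListLaw.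

Variable lambda : forall X : Type, seq (seq X) -> seq (seq X).
Hypothesis lawP : @is_distributive_law list_monad list_monad lambda.

Lemma lambda_map (X Y : Type) (f : X -> Y) (w : seq (seq X)) :
  lambda (map (map f) w) = map (map f) (lambda w).
Proof. exact: (law_natural lawP f w). Qed.

Lemma lambda_seq1 (X : Type) (t : seq X) :
  lambda [:: t] = map (fun x => [:: x]) t.
Proof. exact: (law_etaS lawP t). Qed.

Lemma lambda_singletons (X : Type) (s : seq X) :
  lambda (map (fun x => [:: x]) s) = [:: s].
Proof. exact: (law_etaT lawP s). Qed.

Lemma lambda_flatten (X : Type) (w : seq (seq (seq X))) :
  lambda (flatten w) = map flatten (lambda (map (@lambda X) w)).
Proof. exact: (law_muS lawP w). Qed.

Lemma lambda_map_flatten (X : Type) (w : seq (seq (seq X))) :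
  lambda (map flatten w) = flatten (map (@lambda X) (lambda w)).
Proof. exact: (law_muT lawP w). Qed.

(** Compatibility with the inner multiplication, after naturality moves [erase k] through [lambda]:
    killing a letter in the input acts on [lambda w] product by product. *)
Lemma lambda_filter (k : nat) (w : seq (seq nat)) :
  lambda (map (filter (predC1 k)) w)
    = flatten [seq lambda (map (erase k) s) | s <- lambda w].
Proof.
have -> : map (filter (predC1 k)) w = map flatten (map (map (erase k)) w).
  by rewrite -map_comp; apply: eq_map => s; rewrite /= flatten_map_erase.
by rewrite lambda_map_flatten lambda_map -map_comp.
Qed.

Lemma lambda_map_erase_id (k : nat) (s : seq nat) :
  k \notin s -> lambda (map (erase k) s) = [:: s].
Proof. by move=> /map_erase_id ->; rewrite lambda_singletons. Qed.

Lemma lambda_two_products (w : seq (seq nat)) (p q : seq nat) :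
    map (filter (predC1 0)) (lambda w) = [:: [:: 1]; [:: 2]] ->
    lambda (map (filter (predC1 2)) w) = [:: p] ->
    lambda (map (filter (predC1 1)) w) = [:: q] ->
  lambda w = [:: p; q].
Proof.
rewrite !lambda_filter.
case: (lambda w) => [|s [|t [|? ?]]] //= [s1 t2].
have s2 : 2 \notin s.
  by have := mem_filter (predC1 0) 2 s; rewrite s1 /= => <-.
have t1 : 1 \notin t.
  by have := mem_filter (predC1 0) 1 t; rewrite t2 /= => <-.
(* A product free of the erased letter survives unchanged. It already fills the one-entry result, so
   the other product contributes nothing. *)
rewrite (lambda_map_erase_id s2) (lambda_map_erase_id t1) => -[-> _].
by case: (lambda _) => [[->]|? [|? ?]].
Qed.

Lemma lambda_distrl (X : Type) (a c d : X) :
  lambda [:: [:: a]; [:: c; d]] = [:: [:: a; c]; [:: a; d]].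
Proof.
have base : lambda [:: [:: 0]; [:: 1; 2]] = [:: [:: 0; 1]; [:: 0; 2]].
  apply: lambda_two_products => /=.
  - under eq_map => s do rewrite -flatten_map_erase.
    rewrite (map_comp flatten (map (erase 0))) -lambda_map /=.
    (* The block [[::]] is the empty product put for [0]: [lambda] sends it to [[:: [::]]], and
       flattening drops it. *)
    have := lambda_flatten [:: [::]; [:: [:: 1; 2]]].
    by rewrite /= (lambda_singletons [::]) !lambda_seq1.
  - exact: (lambda_singletons [:: 0; 1]).
  - exact: (lambda_singletons [:: 0; 2]).
(* Naturality along [nth] renames the generic letters [0], [1], [2]; the default is never
   reached. *)
by have := lambda_map (nth a [:: a; c; d]) [:: [:: 0]; [:: 1; 2]]; rewrite base.
Qed.

Lemma lambda_distrr (X : Type) (a b c : X) :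
  lambda [:: [:: a; b]; [:: c]] = [:: [:: a; c]; [:: b; c]].
Proof.
have base : lambda [:: [:: 1; 2]; [:: 0]] = [:: [:: 1; 0]; [:: 2; 0]].
  apply: lambda_two_products => /=.
  - under eq_map => s do rewrite -flatten_map_erase.
    rewrite (map_comp flatten (map (erase 0))) -lambda_map /=.
    have := lambda_flatten [:: [:: [:: 1; 2]]; [::]].
    by rewrite /= (lambda_singletons [::]) !lambda_seq1.
  - exact: (lambda_singletons [:: 1; 0]).
  - exact: (lambda_singletons [:: 2; 0]).
by have := lambda_map (nth a [:: c; a; b]) [:: [:: 1; 2]; [:: 0]]; rewrite base.
Qed.

End ListLaw.

Theorem mainTheorem8 :
  ~ exists lambda : forall X : Type, list_monad (list_monad X) -> list_monad (list_monad X),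
      @is_distributive_law list_monad list_monad lambda.
Proof.
move=> [lambda lawP].
(* Both groupings flatten to [[:: [:: 0; 1]; [:: 2; 3]]]. This one yields the order 02, 03, 12, 13;
   the next yields 02, 12, 03, 13. *)
have := lambda_map_flatten lawP [:: [:: [:: 0]; [:: 1]]; [:: [:: 2; 3]]].
have := lambda_map_flatten lawP [:: [:: [:: 0; 1]]; [:: [:: 2]; [:: 3]]].
rewrite (lambda_distrl lawP) (lambda_distrr lawP) /=.
by rewrite !(lambda_distrl lawP) !(lambda_distrr lawP) => ->.
Qed.
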